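(* For all $1\le p,q\le\infty$ there is a constant $C_{p,q}$, depending only on $p$ and $q$, such that for every integer $n\ge1$, with $K=B_p^n$ and $L=B_q^n$, $$\Gamma_n(K,L)\le C_{p,q}\begin{cases} n^{1/2+1/p-1/q}, & \text{if } 2\le p,q\le\infty,\\ n^{1-1/q}, & \text{if } 1\le p\le2,\\ n^{1-1/q}, & \text{if } 1\le q\le2\le p\le\infty \text{ and } p'>q,\\ n^{1/p}, & \text{if } 1\le q\le2\le p\le\infty\text{ and } p'\le q,\end{cases}$$ where $p'$ is the conjugate index of $p$, $1/p+1/p'=1$.
   Context: $B_p^n$ is the unit ball of $\ell_p^n$, i.e. of $\mathbb{R}^n$ with the $\ell_p$ norm; $1/\infty=0$. A ball in $\mathbb{R}^m$ is a bounded, convex, symmetric set with nonempty interior; $\|\cdot\|_K$ is the norm with unit ball $K$. For balls $K,L\subset\mathbb{R}^m$ and $n\le m$, $\Gamma_n(K,L)=\inf\|A\|\,\|B\|$, where the infimum is over all $n$-dimensional subspaces $E\subset\mathbb{R}^m$ and all linear operators $B:(E,\|\cdot\|_{L\cap E})\to\ell_1^n$, $A:\ell_1^n\to(E,\|\cdot\|_{K\cap E})$ such that $AB=\mathrm{id}_E$ (operator norms with respect to the indicated norms). When $m=n$ this is the factorization constant of the identity $L\to K$ through $\ell_1^n$. *)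

(* Defs.v *)
From HB Require Import structures.
From mathcomp Require Import all_boot all_order all_algebra.
From mathcomp Require Import all_classical all_reals all_analysis.

Set Implicit Arguments.
Unset Strict Implicit.
Unset Printing Implicit Defensive.

Import Order.TTheory GRing.Theory Num.Theory.

Local Open Scope classical_set_scope.
Local Open Scope ring_scope.

(* Only 1 <= p <= +oo is meaningful; the value at -oo is a placeholder. *)
Definition lp_norm (R : realType) (n : nat) (p : \bar R) (x : 'rV[R]_n) : R :=
  match p with
  | r%:E => (\sum_(i < n) `|x 0 i| `^ r) `^ r^-1
  | +oo%E => \big[Order.max/0]_(i < n) `|x 0 i|
  | -oo%E => 0
  end.

Definition lp_ball (R : realType) (n : nat) (p : \bar R) : set 'rV[R]_n :=
  [set x | lp_norm p x <= 1].
Arguments lp_ball {R} n p.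

(* The norm with unit ball K (the Minkowski functional of K), for K bounded,
   convex, symmetric and with nonempty interior.  When E is a subspace and
   vsval : subvs_of E -> V the inclusion, the norm on E with unit ball K `&` E
   is gauge (vsval @^-1` K). *)
Definition gauge (R : realType) (V : lmodType R) (K : set V) (x : V) : R :=
  inf [set t : R | 0 < t /\ K (t^-1 *: x)].

Definition operator_norm (R : realType) (V W : lmodType R)
    (normV : V -> R) (normW : W -> R) (f : V -> W) : \bar R :=
  ereal_sup [set (normW (f x))%:E | x in [set x | normV x <= 1]].

(* An infimum in \bar R, so that an empty set of factorizations gives +oo.
   Composition is that of functions: (A \o B)%VF x = A (B x). *)
Definition Gamma (R : realType) (m n : nat) (K L : set 'rV[R]_m) : \bar R :=
  ereal_inf [set a | exists (E : {vspace 'rV[R]_m})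
      (B : 'Hom(subvs_of E, 'rV[R]_n)) (A : 'Hom('rV[R]_n, subvs_of E)),
    [/\ \dim E = n,
        (A \o B)%VF = \1%VF &
        a = (operator_norm (@lp_norm R n 1%:E) (gauge (vsval @^-1` K)) A *
             operator_norm (gauge (vsval @^-1` L)) (@lp_norm R n 1%:E) B)%E]].
Arguments Gamma {R m} n K L.

(* Main.v *)
(* Take E = R^n.  The identity factors through l_1^n with constant
   |id : l_q -> l_1| <= 2 n^(1 - 1/q), which settles the second and third cases.
   For the other two, factor through the Hartley matrix H with entries
   (cos + sin)(2 pi i j / n) / sqrt n, which is symmetric and orthogonal with
   entries O(1 / sqrt n): thus |H : l_1 -> l_p| = O(n^(1/p - 1/2)), while
   |H : l_q -> l_1| <= sqrt n |id : l_q -> l_2|. *)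
Require Import Defs.
From HB Require Import structures.
From mathcomp Require Import all_boot all_order all_algebra.
From mathcomp Require Import all_classical all_reals all_analysis.
From mathcomp Require Import ring.

Set Implicit Arguments.
Unset Strict Implicit.
Unset Printing Implicit Defensive.

Import Order.TTheory GRing.Theory Num.Theory.

Local Open Scope classical_set_scope.
Local Open Scope ring_scope.

(** * Norm estimates on [R^n] *)

Section LpNorm.
Context {R : realType} {n : nat}.
Implicit Types (p : \bar R) (x : 'rV[R]_n).

Lemma lp_norm_ge0 p x : 0 <= lp_norm p x.
Proof.
case: p => [r| |] //=; first exact: powR_ge0.
by apply: (big_ind (fun a => 0 <= a)) => // a b a0 b0; rewrite le_max a0.
Qed.

(** Powers with positive exponent are monotone, so the outer root can be removed; estimates for
    finite exponents then become estimates on power sums. *)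
Lemma lp_norm_fin_le (r t : R) x : 0 < r -> 0 <= t ->
  (lp_norm r%:E x <= t) = (\sum_(i < n) `|x 0 i| `^ r <= t `^ r).
Proof.
move=> r0 t0 /=; have s0 : 0 <= \sum_(i < n) `|x 0 i| `^ r.
  by apply: sumr_ge0 => i _; exact: powR_ge0.
have powK (a : R) (u v : R) : 0 <= a -> u * v = 1 -> (a `^ u) `^ v = a.
  by move=> a0 uv; rewrite -powRrM uv powRr1.
apply/idP/idP => [h|h].
- rewrite -(powK _ r^-1 r s0) ?mulVf ?gt_eqF//.
  by apply: ge0_ler_powR => //; rewrite ?nnegrE ?powR_ge0// ltW.
- rewrite -(powK t r r^-1 t0) ?mulfV ?gt_eqF//.
  by apply: ge0_ler_powR => //; rewrite ?nnegrE ?powR_ge0// invr_ge0 ltW.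
Qed.

Lemma lp_norm_infty_le (t : R) x : 0 <= t ->
  reflect (forall i, `|x 0 i| <= t) (lp_norm +oo%E x <= t).
Proof.
move=> t0; apply: (iffP idP) => [h i|h].
  by apply: le_trans h; exact: (le_bigmax _ (fun i => `|x 0 i|)).
exact/bigmax_leP.
Qed.

Lemma lp_norm1E x : lp_norm 1%:E x = \sum_(i < n) `|x 0 i|.
Proof.
rewrite /= invr1 powRr1; last by apply: sumr_ge0 => i _; exact: powR_ge0.
by apply: eq_bigr => i _; rewrite powRr1.
Qed.

Lemma lp_norm_coord_le p x i : (1 <= p)%E -> `|x 0 i| <= lp_norm p x.
Proof.
case: p => [r| |] // p1; last exact: (le_bigmax _ (fun i => `|x 0 i|)).
have r0 : 0 < r by apply: lt_le_trans ltr01 _; rewrite lee_fin in p1.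
(* With [t] the norm itself, the power sum is at most [t ^ r]; a coordinate exceeding [t] would
   already make it larger. *)
have := lexx (lp_norm r%:E x); rewrite lp_norm_fin_le ?lp_norm_ge0// => h.
rewrite leNgt; apply/negP => lt.
have := gt0_ltr_powR r0 _ _ lt.
rewrite !nnegrE lp_norm_ge0 normr_ge0 ltNge => /(_ erefl erefl)/negP; apply.
apply: le_trans h; rewrite (bigD1 i)//= lerDl.
by apply: sumr_ge0 => j _; exact: powR_ge0.
Qed.

(** It suffices to prove one inequality for all positive factors: applied to [c^-1] and [c *: x], it
    yields the reverse one. *)
Lemma lp_normZ p (c : R) x : (1 <= p)%E -> 0 < c ->
  lp_norm p (c *: x) = c * lp_norm p x.
Proof.
move=> p1 c0; have hle (d : R) (y : 'rV[R]_n) : 0 < d ->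
    lp_norm p (d *: y) <= d * lp_norm p y.
  move=> d0; have b0 : 0 <= d * lp_norm p y.
    by rewrite mulr_ge0 ?lp_norm_ge0// ltW.
  case: p p1 b0 => [r| |] // p1 b0.
  - have r0 : 0 < r by apply: lt_le_trans ltr01 _; rewrite lee_fin in p1.
    rewrite lp_norm_fin_le// powRM ?lp_norm_ge0 ?(ltW d0)//.
    under eq_bigr do rewrite mxE normrM powRM// (gtr0_norm d0).
    rewrite -mulr_sumr ler_pM2l ?powR_gt0//.
    by rewrite -lp_norm_fin_le ?lp_norm_ge0.
  - apply/lp_norm_infty_le => // i; rewrite mxE normrM (gtr0_norm d0).
    by rewrite ler_pM2l// lp_norm_coord_le.
apply: le_anti; rewrite hle//=.
have := hle c^-1 (c *: x); rewrite invr_gt0 scalerA mulVf ?gt_eqF// scale1r.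
by move=> /(_ c0); rewrite mulrC ler_pdivlMr// mulrC.
Qed.

(** All coordinates are at most 1 in absolute value, so raising them to a power [r >= 1] only
    decreases them. This bounds the identity from [l_1] to [l_p] by 1. *)
Lemma lp_norm_le_lp_norm1 p x : (1 <= p)%E -> lp_norm 1%:E x <= 1 ->
  lp_norm p x <= 1.
Proof.
move=> p1 x1; have xi i : `|x 0 i| <= 1.
  by apply: le_trans x1; exact: lp_norm_coord_le.
case: p p1 => [r| |] // p1; last exact/lp_norm_infty_le.
rewrite lee_fin in p1; rewrite lp_norm_fin_le ?(lt_le_trans ltr01)// powR1.
rewrite lp_norm1E in x1; apply: le_trans x1; apply: ler_sum => i _.
have [->|x0] := eqVneq (x 0 i) 0.
  by rewrite normr0 powR0// gt_eqF// (lt_le_trans ltr01).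
by apply: ge1r_powR => //; rewrite normr_gt0 x0 xi.
Qed.

(** This converts the uniform bound on the entries of the Hartley matrix into a bound on its norm
    from [l_1] to [l_p]. *)
Lemma lp_norm_coord_bound p x (c : R) : (1 <= p)%E -> 0 <= c ->
  (forall i, `|x 0 i| <= c) -> lp_norm p x <= c * n%:R `^ fine p^-1%E.
Proof.
move=> p1 c0 xc; case: p p1 => [r| |] // p1; last first.
  by rewrite invey powRr0 mulr1; apply/lp_norm_infty_le.
have r0 : 0 < r by apply: lt_le_trans ltr01 _; rewrite lee_fin in p1.
rewrite inver gt_eqF//= lp_norm_fin_le ?mulr_ge0 ?powR_ge0//.
rewrite powRM ?powR_ge0// -powRrM mulVf ?gt_eqF// powRr1//.
rewrite -[n in leRHS]card_ord mulr_natr -sumr_const.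
by apply: ler_sum => i _; apply: ge0_ler_powR; rewrite ?nnegrE// ltW.
Qed.

(* Scaling the trivial bound y^s <= y^q + 1 to y = |x_i| n^(1/q) gives
   Hoelder's inequality up to the factor 2. *)
Lemma sum_powR_lp_le q x (s : R) : (0 < n)%N -> (1 <= q)%E ->
  1 <= s -> (s%:E <= q)%E -> lp_norm q x <= 1 ->
  \sum_(i < n) `|x 0 i| `^ s <= 2 * n%:R `^ (1 - s * fine q^-1%E).
Proof.
move=> n0 q1 s1 sq x1; have s0 : 0 < s by apply: lt_le_trans s1.
have n0R : 0 < n%:R :> R by rewrite ltr0n.
have pow1 (a : R) : 0 <= a -> a <= 1 -> a `^ s <= 1.
  move=> a0 a1; have -> : 1 = 1 `^ s :> R by rewrite powR1.
  by apply: ge0_ler_powR; rewrite ?nnegrE// ltW.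
have xi i : `|x 0 i| <= 1 by apply: le_trans x1; exact: lp_norm_coord_le.
case: q q1 sq x1 => [r| |] // q1 sq x1; last first.
  rewrite invey mulr0 subr0 powRr1 ?ler0n//.
  apply: (@le_trans _ _ n%:R); last by rewrite ler_peMl ?ler1n// ltW.
  rewrite -[n in leRHS]card_ord -sumr_const; apply: ler_sum => i _.
  exact: pow1.
rewrite !lee_fin in q1 sq.
have r0 : 0 < r by apply: lt_le_trans q1.
rewrite inver gt_eqF//=.
have N0 : 0 < n%:R `^ r^-1 :> R by exact: powR_gt0.
(* Clearing this denominator turns the goal into a bound by [2 n] on the sum of [y_i ^ s], where
   [y_i = |x_i| n^(1/r)]. *)
have -> : n%:R `^ (1 - s * r^-1) = n%:R / (n%:R `^ r^-1) `^ s :> R.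
  rewrite powRB; last by rewrite (lt0r_neq0 n0R) implybT.
  by rewrite powRr1 ?ler0n// -powRrM [s * _]mulrC.
rewrite mulrA ler_pdivlMr ?powR_gt0// mulr_suml.
rewrite lp_norm_fin_le// powR1 in x1.
(* Here [|x_i|^r n = y_i^r]. Since the [|x_i|^r] add up to at most 1, the sum is at most [n + n]. *)
apply: (@le_trans _ _ (\sum_(i < n) (`|x 0 i| `^ r * n%:R + 1))); last first.
  rewrite big_split/= sumr_const card_ord -mulr_suml.
  by rewrite mulrDl mul1r lerD2r ler_piMl// ltW.
apply: ler_sum => i _; rewrite -powRM ?(ltW N0)//.
have -> : `|x 0 i| `^ r * n%:R = (`|x 0 i| * n%:R `^ r^-1) `^ r.
  by rewrite powRM ?(ltW N0)// -powRrM mulVf ?gt_eqF// powRr1 ?ltW.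
set y := _ * _; have y0 : 0 <= y by rewrite mulr_ge0// ltW.
have [y1|y1] := leP y 1.
  rewrite (@le_trans _ _ 1) ?lerDr ?powR_ge0//.
  exact: pow1.
apply: (@le_trans _ _ (y `^ r)); last by rewrite lerDl.
by apply: ler_powR => //; exact: ltW.
Qed.

(** Coordinates are at most 1 in absolute value, so their squares are below their [q]-th powers: the
    [l_q] ball lies in the Euclidean ball. *)
Lemma sum_sqr_lp_le2 q x : (1 <= q)%E -> (q <= 2%:E)%E -> lp_norm q x <= 1 ->
  \sum_(i < n) x 0 i ^+ 2 <= 1.
Proof.
move=> q1 q2 x1.
have xi i : `|x 0 i| <= 1 by apply: le_trans x1; exact: lp_norm_coord_le.
case: q q1 q2 x1 => [r| |] // q1 q2 x1.
rewrite !lee_fin in q1 q2; rewrite lp_norm_fin_le ?(lt_le_trans ltr01)// in x1.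
rewrite powR1 in x1; apply: le_trans x1; apply: ler_sum => i _.
rewrite -[x 0 i ^+ 2]real_normK ?num_real// -powR_mulrn//.
have [->|x0] := eqVneq (x 0 i) 0.
  by rewrite normr0 powR0 ?pnatr_eq0// powR_ge0.
by apply: ger_powR => //; rewrite normr_gt0 x0 xi.
Qed.

(** Cauchy-Schwarz against the all-ones vector, obtained by summing [(|y_i| - T / w)^2 >= 0] with
    [w = sqrt n]; this choice makes the constant terms add up to exactly [T^2]. *)
Lemma sum_norm_le_sqrt (y : 'rV[R]_n) (T : R) : (0 < n)%N -> 0 < T ->
  \sum_(i < n) y 0 i ^+ 2 <= T ^+ 2 ->
  \sum_(i < n) `|y 0 i| <= Num.sqrt n%:R * T.
Proof.
move=> n0 T0 yT; set w : R := Num.sqrt n%:R.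
have w0 : 0 < w by rewrite sqrtr_gt0 ltr0n.
have w2 : w ^+ 2 = n%:R by rewrite sqr_sqrtr.
have h : \sum_(i < n) (2 * (T / w) * `|y 0 i|) <=
         \sum_(i < n) (y 0 i ^+ 2 + (T / w) ^+ 2).
  apply: ler_sum => i _; rewrite -[y 0 i ^+ 2]real_normK ?num_real//.
  rewrite -subr_ge0; have -> : `|y 0 i| ^+ 2 + (T / w) ^+ 2 -
    2 * (T / w) * `|y 0 i| = (`|y 0 i| - T / w) ^+ 2 by ring.
  exact: sqr_ge0.
rewrite -mulr_sumr big_split/= sumr_const card_ord -[_ *+ n]mulr_natr in h.
have e : (T / w) ^+ 2 * n%:R = T ^+ 2.
  by rewrite -w2 -exprMn divfK ?gt_eqF.
rewrite e in h.
have h2 : 2 * (T / w) * \sum_(i < n) `|y 0 i| <= 2 * T ^+ 2.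
  by apply: le_trans h _; rewrite mulr_natl mulr2n lerD2r.
rewrite -(ler_pM2l (_ : 0 < 2 * (T / w))) ?mulr_gt0 ?invr_gt0//.
apply: le_trans h2 _; rewrite le_eqVlt; apply/orP; left; apply/eqP.
by field; rewrite gt_eqF.
Qed.

End LpNorm.

(** * The Hartley matrix and its orthogonality *)

Section Hartley.
Context {R : realType}.
Implicit Types (t : R) (n : nat).

(** Each term is a difference: [2 sin t cos (2tk) = sin (2tk + t) - sin (2tk - t)]. *)
Lemma sum_cos_telescope t n :
  2 * sin t * \sum_(k < n) cos (2 * t * k%:R) =
  sin (2 * t * n%:R - t) + sin t.
Proof.
elim: n => [|n IH].
  by rewrite big_ord0 !mulr0 sub0r sinN addNr.
rewrite big_ord_recr/= mulrDr IH.
have -> : 2 * t * n.+1%:R - t = 2 * t * n%:R + t by rewrite -[n.+1%:R]natr1; ring.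
by rewrite sinB sinD; ring.
Qed.

(** Each term is a difference: [2 sin t sin (2tk) = cos (2tk - t) - cos (2tk + t)]. *)
Lemma sum_sin_telescope t n :
  2 * sin t * \sum_(k < n) sin (2 * t * k%:R) =
  cos t - cos (2 * t * n%:R - t).
Proof.
elim: n => [|n IH].
  by rewrite big_ord0 !mulr0 sub0r cosN subrr.
rewrite big_ord_recr/= mulrDr IH.
have -> : 2 * t * n.+1%:R - t = 2 * t * n%:R + t by rewrite -[n.+1%:R]natr1; ring.
by rewrite cosB cosD; ring.
Qed.

Lemma cos_natr_2pi d : cos (2 * pi * d%:R) = 1 :> R.
Proof.
elim: d => [|d IH]; first by rewrite mulr0 cos0.
by rewrite -[d.+1%:R]natr1 mulrDr mulr1 mulr_natl cosD2pi -mulr_natl IH.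
Qed.

Lemma sin_natr_2pi d : sin (2 * pi * d%:R) = 0 :> R.
Proof.
elim: d => [|d IH]; first by rewrite mulr0 sin0.
by rewrite -[d.+1%:R]natr1 mulrDr mulr1 mulr_natl sinD2pi -mulr_natl IH.
Qed.

Lemma angle_mul_period n (d : nat) : (0 < n)%N ->
  2 * (pi * d%:R / n%:R) * n%:R = 2 * pi * d%:R :> R.
Proof. by move=> n0; field; rewrite pnatr_eq0 -lt0n. Qed.

Lemma sin_angle_neq0 n d : (0 < d < n)%N -> sin (pi * d%:R / n%:R) != 0 :> R.
Proof.
move=> /andP[d0 dn]; have n0 : (0 < n)%N by exact: leq_trans dn.
rewrite gt_eqF// sin_gt0_pi// divr_gt0 ?mulr_gt0 ?pi_gt0 ?ltr0n//=.
by rewrite ltr_pdivrMr ?ltr0n// ltr_pM2l ?pi_gt0// ltr_nat.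
Qed.

(** For [t = pi d / n] the end terms of the telescoping sum cancel by periodicity, and [sin t] can
    be divided out because [0 < t < pi]. *)
Lemma sum_cos_angle n d : (0 < d < n)%N ->
  \sum_(k < n) cos (2 * (pi * d%:R / n%:R) * k%:R) = 0 :> R.
Proof.
move=> dn; have n0 : (0 < n)%N by case/andP: dn => _; exact: leq_trans.
apply/(mulfI (_ : 2 * sin (pi * d%:R / n%:R) != 0)).
  by rewrite mulf_neq0 ?sin_angle_neq0// pnatr_eq0.
rewrite sum_cos_telescope angle_mul_period// sinB sin_natr_2pi cos_natr_2pi.
by rewrite mul0r mul1r sub0r addNr mulr0.
Qed.

(** The range extends to [2n] because [d] will be a sum of two indices below [n]. Replacing [d] by
    [d - n] shifts every angle by a multiple of [2 pi]; for [d = 0] all terms vanish. *)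
Lemma sum_sin_angle n d : (0 < n)%N -> (d < n + n)%N ->
  \sum_(k < n) sin (2 * (pi * d%:R / n%:R) * k%:R) = 0 :> R.
Proof.
move=> n0; have n0' : n%:R != 0 :> R by rewrite pnatr_eq0 -lt0n.
have small e : (e < n)%N ->
    \sum_(k < n) sin (2 * (pi * e%:R / n%:R) * k%:R) = 0 :> R.
  case: e => [_|e en].
    by rewrite big1// => k _; rewrite mulr0 mul0r mulr0 mul0r sin0.
  apply/(mulfI (_ : 2 * sin (pi * e.+1%:R / n%:R) != 0)).
    by rewrite mulf_neq0 ?sin_angle_neq0// pnatr_eq0.
  rewrite sum_sin_telescope angle_mul_period// cosB sin_natr_2pi cos_natr_2pi.
  by rewrite mul0r mul1r addr0 subrr mulr0.
have [dn _|nd dnn] := ltnP d n; first exact: small.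
have [e de en] : exists2 e, d = (n + e)%N & (e < n)%N.
  by exists (d - n)%N; rewrite ?subnKC// ltn_subLR.
rewrite -[RHS](small e en); apply: eq_bigr => k _; rewrite de.
have -> : 2 * (pi * (n + e)%:R / n%:R) * k%:R =
    2 * (pi * e%:R / n%:R) * k%:R + 2 * pi * k%:R :> R.
  by rewrite natrD; field.
by rewrite sinD sin_natr_2pi cos_natr_2pi mulr0 mulr1 addr0.
Qed.

(** The angle [2 pi i j / n] is grouped as [2 t j] with [t = pi i / n], the shape of the telescoping
    sums. *)
Definition hartley n : 'M[R]_n :=
  \matrix_(i, j) ((cos (2 * (pi * i%:R / n%:R) * j%:R) +
                   sin (2 * (pi * i%:R / n%:R) * j%:R)) / Num.sqrt n%:R).

Lemma hartley_sym n : (hartley n)^T = hartley n.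
Proof.
apply/matrixP => i j; rewrite !mxE.
by rewrite (_ : 2 * (pi * j%:R / n%:R) * i%:R =
  2 * (pi * i%:R / n%:R) * j%:R)//; ring.
Qed.

Lemma hartley_bound n i j : `|hartley n i j| <= 2 / Num.sqrt n%:R.
Proof.
rewrite mxE normrM normfV (ger0_norm (sqrtr_ge0 _)).
rewrite ler_wpM2r ?invr_ge0 ?sqrtr_ge0//.
by rewrite (le_trans (ler_normD _ _))// -[2]/(1 + 1) lerD ?cos_max ?sin_max.
Qed.

(* (cos a + sin a) (cos b + sin b) = cos (a - b) + sin (a + b) *)
Lemma hartleyK n : hartley n *m hartley n = 1%:M.
Proof.
(* Transposing the second factor makes each entry the inner product of rows [i] and [j]. *)
apply/matrixP => i j; rewrite -{2}(hartley_sym n) !mxE.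
have n0 : (0 < n)%N by apply: leq_trans (ltn_ord i).
have n0R : 0 < n%:R :> R by rewrite ltr0n.
have n0' := lt0r_neq0 n0R.
(* The indices are ordered so that [b - a] is a genuine difference of natural numbers; the other
   order follows by commutativity. *)
have key (a b : nat) : (a <= b < n)%N ->
  \sum_(k < n) (cos (2 * (pi * a%:R / n%:R) * k%:R) +
     sin (2 * (pi * a%:R / n%:R) * k%:R)) / Num.sqrt n%:R *
    ((cos (2 * (pi * b%:R / n%:R) * k%:R) +
     sin (2 * (pi * b%:R / n%:R) * k%:R)) / Num.sqrt n%:R) = (a == b)%:R :> R.
  move=> /andP[ab bn].
  transitivity ((\sum_(k < n) cos (2 * (pi * (b - a)%:R / n%:R) * k%:R) +
      \sum_(k < n) sin (2 * (pi * (b + a)%:R / n%:R) * k%:R)) / n%:R : R).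
    rewrite -big_split/= mulr_suml; apply: eq_bigr => k _.
    have s0 : Num.sqrt n%:R != 0 :> R by rewrite gt_eqF// sqrtr_gt0.
    rewrite mulrACA -invfM -expr2 sqr_sqrtr ?ler0n//; congr (_ / _).
    have -> : 2 * (pi * (b - a)%:R / n%:R) * k%:R =
      2 * (pi * b%:R / n%:R) * k%:R - 2 * (pi * a%:R / n%:R) * k%:R :> R.
      by rewrite natrB//; field.
    have -> : 2 * (pi * (b + a)%:R / n%:R) * k%:R =
      2 * (pi * b%:R / n%:R) * k%:R + 2 * (pi * a%:R / n%:R) * k%:R :> R.
      by rewrite natrD; field.
    by rewrite cosB sinD; ring.
  have an := leq_ltn_trans ab bn.
  (* The sine sum always vanishes since [b + a < 2n], so the cosine sum alone separates the diagonal
     from the rest. *)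
  rewrite sum_sin_angle ?addr0//; last by rewrite -addnS leq_add// ltnW.
  have [->|neq] := eqVneq a b.
    rewrite subnn (eq_bigr (fun=> 1)) ?sumr_const ?card_ord ?divff//.
    by move=> k _; rewrite mulr0 mul0r mulr0 mul0r cos0.
  rewrite sum_cos_angle ?mul0r// subn_gt0 ltn_neqAle neq ab/=.
  by rewrite (leq_ltn_trans (leq_subr _ _)).
have [ij|ji] := leqP i j.
- rewrite -[RHS]/((i == j :> nat)%:R) -key ?ij ?ltn_ord//.
  by apply: eq_bigr => k _; rewrite !mxE.
- rewrite -[RHS]/((i == j :> nat)%:R) eq_sym -key ?(ltnW ji) ?ltn_ord//.
  by apply: eq_bigr => k _; rewrite !mxE mulrC.
Qed.

Lemma hartley_isometry n (x : 'rV[R]_n) :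
  \sum_(i < n) (x *m hartley n) 0 i ^+ 2 = \sum_(i < n) x 0 i ^+ 2.
Proof.
have sqE (y : 'rV[R]_n) : \sum_(i < n) y 0 i ^+ 2 = (y *m y^T) 0 0.
  by rewrite mxE; apply: eq_bigr => i _; rewrite mxE expr2.
by rewrite !sqE trmx_mul hartley_sym mulmxA -(mulmxA x) hartleyK mulmx1.
Qed.

End Hartley.

(** * Gauges of sections and upper bounds on [Gamma] *)

Section Gauge.
Context {R : realType} {n : nat}.
Implicit Types (p : \bar R) (E : {vspace 'rV[R]_n}).

Lemma gauge_ge0 (V : lmodType R) (K : set V) (x : V) : 0 <= gauge K x.
Proof.
rewrite /gauge; set S := [set _ | _].
(* By convention [inf] of the empty set is 0. *)
have [->|/set0P S0] := eqVneq S set0; first by rewrite inf0.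
by apply: lb_le_inf => // s [/ltW].
Qed.

Lemma preimage_lp_ballE p E (x : subvs_of E) (t : R) : (1 <= p)%E -> 0 < t ->
  (vsval @^-1` lp_ball n p) (t^-1 *: x) = (lp_norm p (vsval x) <= t).
Proof.
move=> p1 t0; rewrite /preimage /lp_ball/= lp_normZ ?invr_gt0//.
by rewrite mulrC ler_pdivrMr// mul1r.
Qed.

Lemma gauge_lp_ball_le p E (x : subvs_of E) (c : R) : (1 <= p)%E -> 0 < c ->
  lp_norm p (vsval x) <= c -> gauge (vsval @^-1` lp_ball n p) x <= c.
Proof.
move=> p1 c0 xc; apply: ge_inf; first by exists 0 => t [/ltW].
by split => //; rewrite preimage_lp_ballE.
Qed.

(** Elements of the defining set within [e] of the infimum bound the norm by [1 + e] for every
    [e > 0], so attainment of the infimum is not at issue. *)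
Lemma gauge_lp_ball_le1 p E (x : subvs_of E) : (1 <= p)%E ->
  gauge (vsval @^-1` lp_ball n p) x <= 1 -> lp_norm p (vsval x) <= 1.
Proof.
move=> p1 x1; apply/ler_addgt0Pr => e e0.
have : has_inf [set t : R | 0 < t /\ (vsval @^-1` lp_ball n p) (t^-1 *: x)].
  split; last by exists 0 => t [/ltW].
  have t0 : 0 < lp_norm p (vsval x) + 1 by rewrite ltr_wpDl ?lp_norm_ge0.
  (* Adding 1 keeps the witness positive when [x = 0]. *)
  exists (lp_norm p (vsval x) + 1); split => //.
  by rewrite preimage_lp_ballE// lerDl.
move=> /(inf_adherent e0)[t [t0]]; rewrite preimage_lp_ballE// => xt te.
by apply: (le_trans xt); apply: (le_trans (ltW te)); rewrite lerD2r.
Qed.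

(** Reduces the problem to matrices acting on row vectors: [B] is [x *m N] and [A] is [x *m M], with
    [E] the full space, so [A B = id] reads [N *m M = 1]. *)
Lemma Gamma_lp_ball_le p q (M N : 'M[R]_n) (a b : R) :
  (1 <= p)%E -> (1 <= q)%E -> N *m M = 1%:M -> 0 < a ->
  (forall x, lp_norm 1%:E x <= 1 -> lp_norm p (x *m M) <= a) ->
  (forall x, lp_norm q x <= 1 -> lp_norm 1%:E (x *m N) <= b) ->
  (Gamma n (lp_ball n p) (lp_ball n q) <= (a * b)%:E)%E.
Proof.
move=> p1 q1 NM a0 Ma Nb.
set E : {vspace 'rV[R]_n} := fullv.
pose B : 'Hom(subvs_of E, 'rV[R]_n) := linfun (mulmxr N \o vsval).
pose A : 'Hom('rV[R]_n, subvs_of E) := linfun (vsproj E \o mulmxr M).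
have BE x : B x = vsval x *m N by rewrite lfunE.
have AE x : vsval (A x) = x *m M by rewrite lfunE/= vsprojK ?memvf.
have opA : (operator_norm (@lp_norm R n 1%:E)
    (gauge (vsval @^-1` lp_ball n p)) A <= a%:E)%E.
  apply: ge_ereal_sup => _ [x x1 <-]; rewrite lee_fin.
  by apply: gauge_lp_ball_le => //; rewrite AE; exact: Ma.
have opB : (operator_norm (gauge (vsval @^-1` lp_ball n q))
    (@lp_norm R n 1%:E) B <= b%:E)%E.
  apply: ge_ereal_sup => _ [x x1 <-]; rewrite lee_fin BE.
  by apply: Nb; exact: gauge_lp_ball_le1 x1.
apply: (@le_trans _ _ (operator_norm (@lp_norm R n 1%:E)
    (gauge (vsval @^-1` lp_ball n p)) A *
  operator_norm (gauge (vsval @^-1` lp_ball n q))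
    (@lp_norm R n 1%:E) B)%E).
  apply: ereal_inf_lbound; exists E, B, A; split => //.
    by rewrite dimvf /dim/= mul1n.
  apply/lfunP => x; rewrite comp_lfunE id_lfunE; apply: val_inj => /=.
  by rewrite AE BE -mulmxA NM mulmx1.
(* Multiplying the two bounds requires nonnegative operator norms; each supremum includes the
   nonnegative value at the vector 0. *)
have lp0 r : (1 <= r)%E -> lp_norm r (0 : 'rV[R]_n) <= 1.
  move=> r1; apply: lp_norm_le_lp_norm1 => //.
  by rewrite lp_norm1E big1// => i _; rewrite mxE normr0.
rewrite EFinM lee_pmul//.
- apply: (@le_trans _ _ (gauge (vsval @^-1` lp_ball n p) (A 0))%:E).
    by rewrite lee_fin gauge_ge0.
  by apply: ereal_sup_ubound; exists 0 => //=; exact: (lp0 1%E).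
- apply: (@le_trans _ _ (lp_norm 1%:E (B 0))%:E).
    by rewrite lee_fin lp_norm_ge0.
  apply: ereal_sup_ubound; exists 0 => //=.
  by apply: gauge_lp_ball_le => //; rewrite linear0; exact: lp0.
Qed.

Lemma Gamma_lp_ball_id p q : (0 < n)%N -> (1 <= p)%E -> (1 <= q)%E ->
  (Gamma n (lp_ball n p) (lp_ball n q) <=
   (2 * n%:R `^ (1 - fine q^-1%E))%:E)%E.
Proof.
move=> n0 p1 q1; rewrite -[X in X%:E]mul1r.
apply: (@Gamma_lp_ball_le p q 1%:M 1%:M) => //; first by rewrite mulmx1.
- by move=> x x1; rewrite mulmx1; exact: lp_norm_le_lp_norm1.
- move=> x x1; rewrite mulmx1 lp_norm1E -[fine _]mul1r.
  (* First powers are made explicit so that the power-sum bound applies with [s = 1]. *)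
  under eq_bigr do rewrite -[`|_|]powRr1//.
  exact: sum_powR_lp_le.
Qed.

(** [T] bounds the identity from [l_q] to [l_2]. The factor [sqrt n] from Cauchy-Schwarz cancels the
    normalization of the Hartley matrix. *)
Lemma Gamma_lp_ball_hartley p q (T : R) :
  (0 < n)%N -> (1 <= p)%E -> (1 <= q)%E -> 0 < T ->
  (forall x : 'rV[R]_n, lp_norm q x <= 1 ->
     \sum_(i < n) x 0 i ^+ 2 <= T ^+ 2) ->
  (Gamma n (lp_ball n p) (lp_ball n q) <=
   (2 * n%:R `^ fine p^-1%E * T)%:E)%E.
Proof.
move=> n0 p1 q1 T0 qT; have n0R : 0 < n%:R :> R by rewrite ltr0n.
have w0 : 0 < Num.sqrt n%:R :> R by rewrite sqrtr_gt0.
rewrite (_ : _ * T = 2 / Num.sqrt n%:R * n%:R `^ fine p^-1%E *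
    (Num.sqrt n%:R * T)); last by field; rewrite gt_eqF.
apply: (@Gamma_lp_ball_le p q (hartley n) (hartley n)) => //.
- exact: hartleyK.
- by rewrite mulr_gt0 ?powR_gt0 ?divr_gt0.
- move=> x; rewrite lp_norm1E => x1; apply: lp_norm_coord_bound => //.
  move=> j; rewrite mxE (le_trans (ler_norm_sum _ _ _))//.
  apply: (@le_trans _ _ (\sum_(i < n) `|x 0 i| * (2 / Num.sqrt n%:R))).
    by apply: ler_sum => i _; rewrite normrM ler_wpM2l ?hartley_bound.
  by rewrite -mulr_suml ler_piMl// divr_ge0// ltW.
- move=> x x1; rewrite lp_norm1E; apply: sum_norm_le_sqrt => //.
  by rewrite hartley_isometry qT.
Qed.

End Gauge.

(** * The four ranges of exponents *)

Theorem theorem4p9 (R : realType) (p q : \bar R)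
    (hp : (1 <= p)%E) (hq : (1 <= q)%E) :
  exists C : R, forall n : nat, (1 <= n)%N ->
    [/\ (2%:E <= p)%E -> (2%:E <= q)%E ->
          (Gamma n (lp_ball n p) (lp_ball n q) <=
             (C * n%:R `^ (2^-1 + fine p^-1%E - fine q^-1%E))%:E)%E,
        (p <= 2%:E)%E ->
          (Gamma n (lp_ball n p) (lp_ball n q) <=
             (C * n%:R `^ (1 - fine q^-1%E))%:E)%E,
        (q <= 2%:E)%E -> (2%:E <= p)%E -> (q < hoelder_conjugate p)%E ->
          (Gamma n (lp_ball n p) (lp_ball n q) <=
             (C * n%:R `^ (1 - fine q^-1%E))%:E)%E &
        (q <= 2%:E)%E -> (2%:E <= p)%E -> (hoelder_conjugate p <= q)%E ->
          (Gamma n (lp_ball n p) (lp_ball n q) <=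
             (C * n%:R `^ (fine p^-1%E))%:E)%E].
Proof.
(* In the first case one factor 2 comes from the Hartley entries and one from [T]; the other cases
   lose only 2. *)
exists 4 => n n0; have n0R : 0 < n%:R :> R by rewrite ltr0n.
have le24 (e : R) : ((2 * n%:R `^ e)%:E <= (4 * n%:R `^ e)%:E)%E.
  by rewrite lee_fin ler_wpM2r ?powR_ge0// ler_nat.
have id_bound := le_trans (Gamma_lp_ball_id n0 hp hq) (le24 _).
split => [p2 q2|_|_ _ _|q2 _ _]; [|exact: id_bound|exact: id_bound|].
- have -> : 4 * n%:R `^ (2^-1 + fine p^-1%E - fine q^-1%E) =
      2 * n%:R `^ fine p^-1%E * (2 * n%:R `^ (2^-1 - fine q^-1%E)) :> R.
    rewrite mulrACA -powRD ?(lt0r_neq0 n0R) ?implybT//.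
    by congr (_ * _ `^ _); ring.
  apply: Gamma_lp_ball_hartley => //; first by rewrite mulr_gt0 ?powR_gt0.
  (* The power-sum bound with [s = 2]; since [T = 2 n^(1/2 - 1/q)], the square [T^2 = 4 n^(1 - 2/q)]
     dominates it. *)
  move=> x x1; apply: (@le_trans _ _ (2 * n%:R `^ (1 - 2 * fine q^-1%E))).
    rewrite (le_trans _ (sum_powR_lp_le n0 hq _ q2 x1)) ?ler1n//.
    by apply: ler_sum => i _; rewrite powR_mulrn// real_normK ?num_real.
  rewrite exprMn -[(_ `^ _) ^+ 2]powR_mulrn ?powR_ge0// -powRrM.
  rewrite mulrBl mulVf ?pnatr_eq0// [fine _ * 2]mulrC.
  by rewrite ler_wpM2r ?powR_ge0// -natrX ler_nat.
(* For [q <= 2] the Hartley factorization is used with [T = 1]. *)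
- apply: le_trans (le24 _); rewrite -[X in X%:E]mulr1.
  apply: Gamma_lp_ball_hartley => // x x1; rewrite expr1n.
  exact: sum_sqr_lp_le2 x1.
Qed.
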